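(* For every integer $k\ge 1$ there is a constant $c_0(k)$ such that the following holds for every integer $d\ge c_0(k)$. Let $\mathcal{L}_n$ be a family of probability spaces of $d$-regular graphs on $n$ vertices that is dominated by $\mathcal{G}_{n,d}$, $\mathcal{H}_{n,d}$, $\mathcal{I}_{n,d}$ or $\mathcal{J}_{n,d}$. Then the random $d$-regular graph $G$ in $\mathcal{L}_n$ has the following property with high probability: for every pair of disjoint sets $X,Y\subseteq V(G)$, each of size at least $\frac{n}{6\cdot 3^{k-2}}$, there are at least $\frac{dn}{2(6\cdot 3^{k-2})^2}$ edges $\{x,y\}$ of $G$ with $x\in X$, $y\in Y$.
   Context: Here $d$ is fixed and ''with high probability'' means with probability tending to $1$ as $n\to\infty$ (through those $n$ for which the model in question is defined). Graphs may have loops and multiple edges; edges are counted with multiplicity. Random regular graph models (Friedman), all on vertex set $\{1,\dots,n\}$: - $\mathcal{G}_{n,d}$ ($d$ even): choose $d/2$ permutations $\pi_1,\dots,\pi_{d/2}$ of $\{1,\dots,n\}$ independently and uniformly, and take the edges $\{i,\pi_j(i)\}$ for $1\le i\le n$, $1\le j\le d/2$, with multiplicity (a loop contributes $2$ to the degree). - $\mathcal{H}_{n,d}$ ($d$ even): as $\mathcal{G}_{n,d}$, but each $\pi_j$ is uniform among the permutations consisting of a single cycle of length $n$. - $\mathcal{I}_{n,d}$ ($n$ even): the union, with multiplicity, of $d$ independent uniformly random perfect matchings of $\{1,\dots,n\}$. - $\mathcal{J}_{n,d}$ ($n$ odd): the union, with multiplicity, of $d$ independent uniformly random near-perfect matchings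 of $\{1,\dots,n\}$ (matchings covering all but one vertex), each supplemented by a half-loop at its unmatched vertex (a half-loop contributes $1$ to the degree). Domination: for two families of probability spaces $(\Omega_n,\mathcal{F}_n,\mu_n)$ and $(\Omega_n,\mathcal{F}_n,\nu_n)$, $n=1,2,\dots$, over the same sets and sigma-algebras, $\mu=\{\mu_n\}$ dominates $\nu=\{\nu_n\}$ if for every family of measurable events $\{E_n\}$, $\mu_n(E_n)\to 0$ implies $\nu_n(E_n)\to 0$. *)

(* Defs.v *)
From HB Require Import structures.
From mathcomp Require Import all_boot all_order all_algebra all_fingroup.
From mathcomp Require Import all_classical all_reals all_analysis.

Set Implicit Arguments.
Unset Strict Implicit.
Unset Printing Implicit Defensive.

Import Order.TTheory GRing.Theory Num.Theory.
Import numFieldNormedType.Exports.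

Local Open Scope classical_set_scope.
Local Open Scope ring_scope.

(* A multigraph on {0, ..., n-1} is given by the number of edges {x, y} for
   each x, y (for x = y: the number of whole loops at x) and the number of
   half-loops at each vertex. *)
Record mgraph (n : nat) := MGraph {
  mgraph_data : {ffun 'I_n * 'I_n -> nat} * {ffun 'I_n -> nat} ;
  _ : [forall x, forall y, mgraph_data.1 (x, y) == mgraph_data.1 (y, x)]
}.

HB.instance Definition _ n := [isSub for @mgraph_data n].
HB.instance Definition _ n := [Countable of mgraph n by <:].

Section Multigraphs.
Variable n : nat.
Implicit Types (g : mgraph n) (x y : 'I_n) (X Y : {set 'I_n}).

Definition mult g x y : nat := (mgraph_data g).1 (x, y).
Definition halfloops g x : nat := (mgraph_data g).2 x.

(* The sum counts a whole loop at x once, so it is counted once more. *)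
Definition degree g x : nat :=
  (\sum_y mult g x y + mult g x x + halfloops g x)%N.

Definition regular (d : nat) g : Prop := forall x, degree g x = d.

(* For disjoint X and Y this is the number of edges between X and Y, counted
   with multiplicity. *)
Definition edges_between g X Y : nat :=
  (\sum_(x in X) \sum_(y in Y) mult g x y)%N.

Fact mk_mgraph_subproof (m : 'I_n -> 'I_n -> nat) (h : 'I_n -> nat) :
  (forall x y, m x y = m y x) ->
  [forall x, forall y,
    ([ffun p => m p.1 p.2], [ffun x => h x]).1 (x, y)
    == ([ffun p => m p.1 p.2], [ffun x => h x]).1 (y, x)].
Proof. by move=> sm; apply/'forall_forallP => x y; rewrite !ffunE sm. Qed.

Definition mk_mgraph m h sm : mgraph n := MGraph (@mk_mgraph_subproof m h sm).

Fact empty_mgraph_sym x y : (fun _ _ => 0%N : nat) x y = (fun _ _ => 0%N) y x.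
Proof. by []. Qed.

Definition empty_mgraph : mgraph n :=
  mk_mgraph (fun=> 0%N) empty_mgraph_sym.

End Multigraphs.

HB.instance Definition _ n := isPointed.Build (mgraph n) (empty_mgraph n).
HB.instance Definition _ n :=
  @isMeasurable.Build default_measure_display (mgraph n)
    discrete_measurable discrete_measurable0
    discrete_measurableC discrete_measurableU.

Section GraphConstructions.
Variables (n r : nat).
Implicit Types (x y : 'I_n).

(* Pairs (j, i) are counted, so a 2-cycle (x y) of s j gives two edges {x, y},
   and a fixed point gives one whole loop. *)
Definition perm_mult (s : 'I_r -> 'S_n) x y : nat :=
  #|[pred p : 'I_r * 'I_n | ([set p.2; s p.1 p.2] == [set x; y])%SET]|.

Fact perm_mult_sym s x y : perm_mult s x y = perm_mult s y x.
Proof. by apply: eq_card => p; rewrite !inE (finset.setUC [set x]%SET). Qed.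

Definition perm_graph (s : 'I_r -> 'S_n) : mgraph n :=
  mk_mgraph (fun=> 0%N) (perm_mult_sym s).

Definition matching_mult (M : 'I_r -> {set {set 'I_n}}) x y : nat :=
  #|[pred j | ([set x; y] \in M j)%SET]|.

Fact matching_mult_sym M x y : matching_mult M x y = matching_mult M y x.
Proof. by apply: eq_card => j; rewrite !inE (finset.setUC [set x]%SET). Qed.

Definition matching_graph (M : 'I_r -> {set {set 'I_n}}) : mgraph n :=
  mk_mgraph (fun x => #|[pred j | x \notin finset.cover (M j)]|) (matching_mult_sym M).

End GraphConstructions.

Definition full_cycle n (s : 'S_n) : bool := #|porbits s| == 1%N.

Definition matching n (M : {set {set 'I_n}}) : bool :=
  finset.trivIset M && [forall e in M, #|e| == 2%N].
Definition perfect_matching n (M : {set {set 'I_n}}) : bool :=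
  matching M && (finset.cover M == [set: 'I_n]%SET).
Definition near_perfect_matching n (M : {set {set 'I_n}}) : bool :=
  matching M && (#|~: finset.cover M| == 1%N).

Section UniformLaw.
Context {R : realType} {Om : finType} {n : nat}.
Variable X : Om -> mgraph n.

(* The law of the random graph X w for w uniform in Om (zero if Om is empty). *)
Definition uniform_law (E : set (mgraph n)) : \bar R :=
  (#|[pred w | X w \in E]|%:R / #|Om|%:R)%:E.

Let law0 : uniform_law set0 = 0%E.
Proof.
rewrite /uniform_law eq_card0 ?mul0r // => w.
by rewrite !inE; apply/negbTE/negP; rewrite inE.
Qed.

Let law_ge0 E : (0 <= uniform_law E)%E.
Proof. by rewrite lee_fin divr_ge0. Qed.

Let law_sigma_additive : semi_sigma_additive uniform_law.
Proof.
have c_ge0 : 0 <= (#|Om|%:R : R)^-1 by rewrite invr_ge0.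
pose m := mscale (NngNum c_ge0) (msum
  (fun i => \d_(nth (empty_mgraph n) [seq X w | w <- enum Om] i)) #|Om|).
suff -> : uniform_law = m by exact: measure_semi_sigma_additive.
apply/funext => E; rewrite /uniform_law /m /mscale /= /msum /= mulrC EFinM.
congr (_ * _)%E; rewrite sumEFin; congr (_%:E).
rewrite [in RHS]cardE -(big_mkord xpredT
  (fun i => \1_E (nth (empty_mgraph n) [seq X w | w <- enum Om] i) : R)).
rewrite -(size_map X) -(big_nth (empty_mgraph n) xpredT
  (fun g => \1_E g : R)) big_map big_enum /= -sum1_card natr_sum.
by rewrite big_mkcond; apply: eq_bigr => w _; rewrite indicE inE; case: ifP.
Qed.

HB.instance Definition _ := isMeasure.Build _ _ _ uniform_law
  law0 law_ge0 law_sigma_additive.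

End UniformLaw.

(* Friedman's models G_{n,d}, H_{n,d}, I_{n,d} and J_{n,d}. *)
Inductive model := PermModel | CycleModel | MatchingModel | NearMatchingModel.

Definition model_defined (m : model) (d n : nat) : bool :=
  (0 < n)%N && match m with
  | PermModel | CycleModel => ~~ odd d
  | MatchingModel => ~~ odd n
  | NearMatchingModel => odd n
  end.

(* Independent uniform choices are a uniform choice of a finite function. *)
Definition model_law (R : realType) (m : model) (d n : nat) :
    {measure set (mgraph n) -> \bar R} :=
  match m with
  | PermModel =>
      uniform_law (fun s : {ffun 'I_d./2 -> 'S_n} => perm_graph s)
  | CycleModel =>
      uniform_law (fun s : {ffun 'I_d./2 -> {c : 'S_n | full_cycle c}} =>
        perm_graph (fun j => val (s j)))
  | MatchingModel =>
      uniform_law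
        (fun M : {ffun 'I_d -> {M : {set {set 'I_n}} | perfect_matching M}} =>
          matching_graph (fun j => val (M j)))
  | NearMatchingModel =>
      uniform_law
        (fun M : {ffun 'I_d ->
                    {M : {set {set 'I_n}} | near_perfect_matching M}} =>
          matching_graph (fun j => val (M j)))
  end.

(* Families of probability spaces indexed by the n in D; their values at the
   other n are irrelevant. *)
Definition dominates (R : realType) (disp : measure_display)
    (T : nat -> measurableType disp) (D : set nat)
    (mu nu : forall n, {measure set (T n) -> \bar R}) : Prop :=
  forall E : forall n, set (T n), (forall n, measurable (E n)) ->
    mu n (E n) @[n --> within D \oo] --> 0%E ->
    nu n (E n) @[n --> within D \oo] --> 0%E.

Definition whp (R : realType) (disp : measure_display)
    (T : nat -> measurableType disp) (D : set nat)
    (nu : forall n, {measure set (T n) -> \bar R})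
    (P : forall n, T n -> Prop) : Prop :=
  nu n [set g | P n g] @[n --> within D \oo] --> 1%E.

(* The exponent k - 2 is an integer, equal to -1 for k = 1. *)
Definition many_edges_between (R : realType) (k d n : nat) (g : mgraph n) :
    Prop :=
  let s : R := 6 * 3 ^ (k%:Z - 2) in
  forall X Y : {set 'I_n}, (X :&: Y = finset.set0)%SET ->
    n%:R / s <= #|X|%:R -> n%:R / s <= #|Y|%:R ->
    d%:R * n%:R / (2 * s ^+ 2) <= (edges_between g X Y)%:R.

(* Main.v *)
(* For disjoint X and Y the number of X-Y edges contributed by one permutation or
   matching is a Lipschitz function of a uniform element of S_n: directly for
   G_{n,d}, and after averaging over the action of S_n by relabelling vertices
   for the other three models.  Conditioning on the images of the points one at a
   time gives the moment bound E exp(-th f) <= exp(-th E f + 128 th^2 n), and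
   2-transitivity of S_n gives E f >= |X||Y|/n for a matching and twice this for a
   permutation.  Multiplying over the independent choices with th of order s^-2
   shows that a fixed pair (X, Y) is bad with probability at most
   exp(- d n / (2048 s^4)), which for large d beats the 4^n pairs (X, Y). *)

Require Import Defs.
From mathcomp Require Import all_boot all_order all_algebra all_fingroup.
From mathcomp Require Import all_classical all_reals all_analysis.
From mathcomp Require Import ring lra.

Set Implicit Arguments.
Unset Strict Implicit.
Unset Printing Implicit Defensive.

Import Order.TTheory GRing.Theory Num.Theory.
Import numFieldNormedType.Exports.

Local Open Scope classical_set_scope.
Local Open Scope ring_scope.

(** * Finite averages and their exponential moments *)

Section Mean.
Context {R : realType} {I : finType}.
Implicit Types (P : pred I) (F G : I -> R).

Definition mean P F : R := (\sum_(i | P i) F i) / #|P|%:R.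

Lemma meanE P F : (0 < #|P|)%N -> \sum_(i | P i) F i = #|P|%:R * mean P F.
Proof.
by move=> P0; rewrite /mean mulrC mulfVK // pnatr_eq0 -lt0n.
Qed.

Lemma ler_mean P F G : (forall i, P i -> F i <= G i) -> mean P F <= mean P G.
Proof. by move=> FG; rewrite ler_wpM2r ?invr_ge0 // ler_sum. Qed.

Lemma mean_cst P (a : R) : (0 < #|P|)%N -> mean P (fun=> a) = a.
Proof.
by move=> P0; rewrite /mean sumr_const -[a *+ _]mulr_natr mulfK // pnatr_eq0 -lt0n.
Qed.

Lemma meanD P F G : mean P (fun i => F i + G i) = mean P F + mean P G.
Proof. by rewrite /mean big_split mulrDl. Qed.

Lemma meanZ P (a : R) F : mean P (fun i => a * F i) = a * mean P F.
Proof. by rewrite /mean -mulr_sumr mulrA. Qed.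

Lemma meanB P F G : mean P (fun i => F i - G i) = mean P F - mean P G.
Proof. by rewrite /mean sumrB mulrBl. Qed.

Lemma ler_norm_mean P F (a : R) : (0 < #|P|)%N ->
  (forall i, P i -> `|F i| <= a) -> `|mean P F| <= a.
Proof.
move=> P0 Fa; rewrite ler_norml -{1}(mean_cst (- a) P0) -{2}(mean_cst a P0).
by apply/andP; split; apply: ler_mean => i /Fa; rewrite ler_norml => /andP[].
Qed.

End Mean.

(* 1 / (1 - x) <= 1 + x + 2 x^2, and expR (- x) >= 1 - x. *)
Lemma expR_le_quadratic {R : realType} (x : R) :
  x <= 1 / 2 -> expR x <= 1 + x + 2 * x ^+ 2.
Proof.
move=> x2; rewrite -[expR x]invrK -expRN.
have x1 : 0 < 1 - x by lra.
apply: (@le_trans _ _ (1 - x)^-1).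
  by rewrite lef_pV2 ?posrE ?expR_gt0 // expR_ge1Dx.
rewrite -[_^-1]mul1r ler_pdivrMr // -subr_ge0.
have -> : (1 + x + 2 * x ^+ 2) * (1 - x) - 1 = x ^+ 2 * (1 - 2 * x) by ring.
by rewrite mulr_ge0 ?sqr_ge0 //; lra.
Qed.

(** A weak form of Hoeffding's lemma. After centring at the mean, the linear term of the quadratic
    bound on [expR] averages to zero, and the remaining [1 + 2 (t c)^2] is at most its
    exponential. *)
Lemma mgf_le_expR {R : realType} {I : finType} (P : pred I) (g : I -> R)
    (c t : R) : (0 < #|P|)%N ->
  (forall i j, P i -> P j -> `|g i - g j| <= c) -> `|t| * c <= 1 / 2 ->
  mean P (fun i => expR (t * g i)) <= expR (t * mean P g + 2 * (t * c) ^+ 2).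
Proof.
move=> P0 gc tc; set m := mean P g.
have gm i : P i -> `|g i - m| <= c.
  move=> Pi; rewrite -{1}[g i](mean_cst _ P0) -meanB.
  by apply: ler_norm_mean => // j; apply: gc.
apply: (@le_trans _ _ (mean P (fun i =>
    expR (t * m) * (1 + t * (g i - m) + 2 * (t * c) ^+ 2)))).
  apply: ler_mean => i Pi.
  have -> : t * g i = t * m + t * (g i - m) by ring.
  rewrite expRD ler_wpM2l ?expR_ge0 //.
  (* This bound serves twice: it keeps the argument below [1 / 2], where the quadratic bound is
     valid, and it controls the square. *)
  have le_t : `|t * (g i - m)| <= `|t| * c by rewrite normrM ler_wpM2l ?gm.
  apply: le_trans (expR_le_quadratic _) _.
    by apply: le_trans (ler_norm _) _; apply: le_trans le_t tc.
  rewrite lerD2l ler_wpM2l // -[leLHS]real_normK ?num_real //.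
  rewrite -[leRHS]real_normK ?num_real // ler_sqr ?nnegrE //.
  by rewrite [in leRHS]normrM (le_trans le_t) // ler_wpM2l // ler_norm.
rewrite meanZ expRD ler_wpM2l ?expR_ge0 //.
have -> : mean P (fun i => 1 + t * (g i - m) + 2 * (t * c) ^+ 2) =
    1 + 2 * (t * c) ^+ 2.
  by rewrite !meanD meanZ meanB !mean_cst // -/m subrr mulr0 addr0.
exact: expR_ge1Dx.
Qed.

(** * Concentration of Lipschitz functions of a uniform permutation *)

Section PermConcentration.
Context {R : realType} {T : finType}.
Implicit Types (S : {set T}) (f : {perm T} -> R) (p q : {perm T}).

(** Each permutation [p] of [S] factors uniquely as [q * tperm u v] with [v = p u] and [q] fixing
    [u]: revealing [v] first is what drives the induction on [S]. *)
Lemma sum_perm_on S u f : u \in S ->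
  \sum_(p | perm_on S p) f p =
  \sum_(v in S) \sum_(q | perm_on (S :\ u)%SET q) f (q * tperm u v)%g.
Proof.
move=> uS; rewrite (partition_big (fun p : {perm T} => p u) (mem S)); last first.
  by move=> p pS; rewrite /= perm_closed.
apply: eq_bigr => v vS /=.
rewrite (reindex_onto (fun q => q * tperm u v)%g (fun p => p * tperm u v)%g);
  last by move=> p _; rewrite -mulgA tperm2 mulg1.
apply: eq_bigl => q; rewrite -mulgA tperm2 mulg1 eqxx andbT.
have tS : perm_on S (tperm u v).
  apply: fintype.subset_trans (tperm_on u v) _.
  by rewrite finset.subUset !finset.sub1set uS.
apply/andP/idP => [[qS]|qS].
  rewrite permM => /eqP quv.
  have qu : q u = u by apply: (@perm_inj _ (tperm u v)); rewrite quv tpermL.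
  have {}qS : perm_on S q.
    by have := perm_onM qS tS; rewrite -mulgA tperm2 mulg1.
  apply/fintype.subsetP => x qx; rewrite !inE (fintype.subsetP qS) // andbT.
  by apply: contraNneq qx => ->; rewrite qu.
have qu : q u = u by rewrite (out_perm qS) // !inE eqxx.
rewrite permM qu tpermL eqxx; split => //; apply: perm_onM => //.
by apply: fintype.subset_trans qS _; rewrite finset.subD1set.
Qed.

Lemma card_perm_on_gt0 S : (0 < #|perm_on S|)%N.
Proof. by apply/card_gt0P; exists 1%g; apply: perm_on1. Qed.

Lemma mean_perm_on S u f : u \in S ->
  mean (perm_on S) f =
  mean (mem S) (fun v =>
    mean (perm_on (S :\ u)%SET) (fun q => f (q * tperm u v)%g)).
Proof.
move=> uS; have [/= S0] : (0 < #|S|)%N by apply/card_gt0P; exists u.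
have cS : (#|perm_on S|%:R : R) = #|S|%:R * #|perm_on (S :\ u)%SET|%:R.
  have := sum_perm_on (fun=> 1 : R) uS.
  under [in RHS]eq_bigr do rewrite sumr_const.
  by rewrite !sumr_const => ->; rewrite mulr_natl.
rewrite /mean (sum_perm_on f uS) cS -mulr_suml -!mulrA invfM.
by rewrite [_^-1 * #|S|%:R^-1]mulrC.
Qed.

(* A permutation of S is q * tperm u v with v uniform in S and q a permutation of
   S :\ u; varying v changes the mean of f over q by at most 2c. *)
Lemma perm_on_mgf S f (c t : R) :
  (forall p u v, `|f (tperm u v * p)%g - f p| <= c) ->
  `|t| * (2 * c) <= 1 / 2 ->
  mean (perm_on S) (fun p => expR (t * f p)) <=
  expR (t * mean (perm_on S) f + 8 * (t * c) ^+ 2 * #|S|%:R).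
Proof.
move En : #|S| => n; elim: n S En f => [|n IH] S En f fc tc.
  have -> : S = finset.set0 by apply/eqP; rewrite -cards_eq0 En.
  have m1 (F : {perm T} -> R) : mean (perm_on finset.set0) F = F 1%g.
    have P1 (p : {perm T}) : perm_on finset.set0 p = (p == 1%g).
      apply/idP/eqP => [p0|->]; last exact: perm_on1.
      by apply: (perm_on_id p0); rewrite cards0.
    rewrite /mean (eq_bigl _ _ P1) big_pred1_eq.
    have -> : #|(perm_on finset.set0 : pred {perm T})| = 1%N.
      by rewrite -(card1 (1%g : {perm T})); apply: eq_card => p; exact: P1.
    by rewrite divr1.
  by rewrite !m1 mulr0 addr0.
have [u uS] : exists u, u \in S by apply/card_gt0P; rewrite En.
have {}En : #|(S :\ u)%SET| = n by move: En; rewrite (cardsD1 u) uS => -[].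
pose g v := mean (perm_on (S :\ u)%SET) (fun q => f (q * tperm u v)%g).
have IHg v : mean (perm_on (S :\ u)%SET) (fun q => expR (t * f (q * tperm u v)%g))
    <= expR (8 * (t * c) ^+ 2 * n%:R) * expR (t * g v).
  rewrite -expRD addrC; apply: (IH _ En (fun q => f (q * tperm u v)%g)) => //.
  by move=> p a b; rewrite -mulgA.
have gc v w : v \in S -> w \in S -> `|g v - g w| <= 2 * c.
  (* At [u] the transposition is trivial, so any two values are compared through [g u], at the price
     of a factor 2. *)
  suff gu z : `|g z - g u| <= c.
    move=> _ _; have -> : g v - g w = (g v - g u) - (g w - g u) by ring.
    apply: le_trans (ler_normB _ _) _; have := gu v; have := gu w; lra.
  rewrite -meanB; apply: ler_norm_mean; first exact: card_perm_on_gt0.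
  move=> q _; rewrite tperm1 mulg1.
  (* Conjugating by [q] carries the transposition to the left, where the Lipschitz hypothesis
     applies. *)
  have -> : (q * tperm u z = tperm (q^-1 u) (q^-1 z) * q)%g.
    by rewrite -tpermJ conjgE invgK -!mulgA mulVg mulg1.
  exact: fc.
rewrite !(mean_perm_on _ uS).
apply: le_trans (ler_mean (fun v _ => IHg v)) _.
rewrite meanZ.
(* Spread [2 * c] costs [2 (2 t c)^2 = 8 (t c)^2] for each point revealed. *)
have := @mgf_le_expR R T (mem S) g (2 * c) t _ gc tc.
have -> : (0 < #|mem S|)%N by apply/card_gt0P; exists u.
move=> /(_ isT) h; apply: le_trans (ler_wpM2l (expR_ge0 _) h) _.
rewrite -expRD ler_expR -(natr1 n) -/g.
by rewrite le_eqVlt; apply/orP; left; apply/eqP; ring.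
Qed.

End PermConcentration.

(** * Pair statistics of a random permutation *)

Section PairSums.
Context {R : realType} {T : finType}.
Implicit Types (X Y : {set T}) (p : {perm T}) (u v : T).

Lemma perm_mgf (f : {perm T} -> R) (c t : R) :
  (forall p u v, `|f (tperm u v * p)%g - f p| <= c) ->
  `|t| * (2 * c) <= 1 / 2 ->
  mean predT (fun p => expR (t * f p)) <=
  expR (t * mean predT f + 8 * (t * c) ^+ 2 * #|T|%:R).
Proof.
move=> fc tc; have := perm_on_mgf [set: T]%SET fc tc.
have permT p : perm_on [set: T]%SET p by apply/fintype.subsetP => x; rewrite inE.
have meanT F : mean (perm_on [set: T]%SET) F = mean predT F :> R.
  rewrite /mean (eq_bigl predT) // (_ : #|_| = #|{: {perm T}}|) //.
  by apply: eq_card => p; exact: permT.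
by rewrite !meanT cardsT.
Qed.

(** [phi] sees both points and both images, so that two situations are covered: [p] is itself the
    random object (a test on [u] and [p u]), or [p] relabels a fixed cycle or matching [m] (a test
    on [p u] and [p v]). *)
Definition pair_sum (m : rel T) (phi : T -> T -> T -> T -> bool) p : nat :=
  (\sum_u \sum_v (m u v && phi u (p u) v (p v)))%N.

(** Only pairs of [m] meeting [a] or [b] can change. Each of these two points is the first entry of
    at most one pair and the second entry of at most one, so at most four terms change, each by at
    most 1. *)
Lemma pair_sum_lipschitz (m : rel T) phi p a b :
  (forall u, \sum_v m u v <= 1)%N -> (forall v, \sum_u m u v <= 1)%N ->
  `|(pair_sum m phi (tperm a b * p)%g)%:R - (pair_sum m phi p)%:R| <= 4 :> R.
Proof.
move=> row col; rewrite /pair_sum !natr_sum -sumrB.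
have two (F : T -> nat) : (forall u, F u <= 1)%N ->
    (\sum_u (u \in [set a; b]%SET) * F u <= 2)%N.
  move=> F1; apply: (@leq_trans #|[set a; b]%SET|); last first.
    by rewrite cards2; case: (_ != _).
  rewrite -sum1_card [leqRHS]big_mkcond; apply: leq_sum => u _.
  by case: (u \in _); rewrite ?mul1n.
apply: (@le_trans _ _ (\sum_u \sum_v
  ((u \in [set a; b]%SET) * m u v + (v \in [set a; b]%SET) * m u v)%N%:R)).
  apply: le_trans (ler_norm_sum _ _ _) _; apply: ler_sum => u _.
  rewrite !natr_sum -sumrB.
  apply: le_trans (ler_norm_sum _ _ _) _; apply: ler_sum => v _.
  case: (m u v) => /=; last by rewrite subrr normr0.
  have same w : w \notin [set a; b]%SET -> (tperm a b * p)%g w = p w.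
    by rewrite !inE negb_or => /andP[wa wb]; rewrite permM tpermD // eq_sym.
  have b1 (x y : bool) : `|x%:R - y%:R| <= 1 :> R.
    by case: x y => [] [] /=; rewrite ?(subrr, subr0, sub0r, normr0, normrN, normr1).
  have [_|ua] := boolP (u \in _).
    by apply: le_trans (b1 _ _) _; rewrite ler1n.
  have [_|va] := boolP (v \in _).
    by apply: le_trans (b1 _ _) _; rewrite ler1n.
  by rewrite !same // subrr normr0.
under eq_bigr do rewrite -natr_sum; rewrite -natr_sum.
have -> : (\sum_u \sum_v
    ((u \in [set a; b]%SET) * m u v + (v \in [set a; b]%SET) * m u v) =
    \sum_u (u \in [set a; b]%SET) * (\sum_v m u v) +
    \sum_v (v \in [set a; b]%SET) * (\sum_u m u v))%N.
  under eq_bigr do rewrite big_split /=; rewrite big_split /=; congr addn.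
    by apply: eq_bigr => u _; rewrite big_distrr.
  by rewrite exchange_big; apply: eq_bigr => u _; rewrite big_distrr.
by rewrite (ler_nat R _ 4) (leq_add (two _ row) (two _ col)).
Qed.

(** Lipschitz constant 4 turns [8 (t c)^2] into [128 th^2] and the smallness condition into
    [th <= 1 / 16]. The exponent is negative, so a lower bound [mu] on the mean suffices. *)
Lemma pair_sum_mgf (m : rel T) phi (th mu : R) :
  (forall u, \sum_v m u v <= 1)%N -> (forall v, \sum_u m u v <= 1)%N ->
  0 <= th <= 1 / 16 -> mu <= mean predT (fun p => (pair_sum m phi p)%:R) ->
  mean predT (fun p => expR (- th * (pair_sum m phi p)%:R)) <=
  expR (- th * mu + 128 * th ^+ 2 * #|T|%:R).
Proof.
move=> row col /andP[th0 th1] hmu.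
apply: le_trans (perm_mgf (c := 4) _ _) _.
- by move=> p a b; apply: pair_sum_lipschitz.
- by rewrite normrN ger0_norm //; lra.
rewrite ler_expR; apply: lerD; first by rewrite !mulNr lerN2 ler_wpM2l.
by rewrite le_eqVlt; apply/orP; left; apply/eqP; ring.
Qed.

Lemma card_perm_gt0 : (0 < #|{: {perm T}}|)%N.
Proof. by apply/card_gt0P; exists 1%g. Qed.

Lemma sum_perm_mem X p : (\sum_u (p u \in X))%N = #|X|.
Proof.
rewrite -sum1_card [RHS]big_mkcond [RHS](reindex_inj (@perm_inj _ p)).
by apply: eq_bigr => u _; case: (_ \in _).
Qed.

(** By symmetry the mean does not depend on [u], and for every [p] the sum over all points is
    [|X|]. *)
Lemma mean_mem X u :
  mean predT (fun p => (p u \in X)%:R) = #|X|%:R / #|T|%:R :> R.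
Proof.
pose N v : R := mean predT (fun p => (p v \in X)%:R).
have NE v : N v = N u.
  rewrite /N /mean (reindex_inj (mulgI (tperm u v))); congr (_ / _).
  by apply: eq_bigr => p _; rewrite permM tpermR.
have T0 : (0 < #|T|)%N by apply/card_gt0P; exists u.
apply: (@mulIf _ #|T|%:R); first by rewrite pnatr_eq0 -lt0n.
rewrite mulfVK ?pnatr_eq0 -?lt0n // -/(N u) mulr_natr.
have <- : \sum_v N v = N u *+ #|T|.
  by rewrite (eq_bigr _ (fun v _ => NE v)) sumr_const.
rewrite -mulr_suml exchange_big /=.
under eq_bigr do rewrite -natr_sum sum_perm_mem.
exact: (mean_cst _ card_perm_gt0).
Qed.

(** By 2-transitivity all pairs of distinct points have the same mean. Pairs with equal entries
    contribute nothing since [X] and [Y] are disjoint, and for each [p] the total over all pairs is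
    [|X| |Y|]. *)
Lemma mean_pair X Y u v : (X :&: Y = finset.set0)%SET -> u != v ->
  mean predT (fun p => ((p u \in X) && (p v \in Y))%:R) =
  #|X|%:R * #|Y|%:R / (#|T|%:R * #|T|.-1%:R) :> R.
Proof.
move=> XY uv.
pose N a b : R := mean predT (fun p => ((p a \in X) && (p b \in Y))%:R).
have NE a b : N a b = N u v *+ (a != b).
  have [<-|ab] /= := eqVneq a b.
    rewrite /N /mean big1 ?mul0r // => p _.
    case: (boolP (_ && _)) => // h.
    by have := finset.in_set0 (p a); rewrite -XY inE h.
  (* First [u] goes to [a], then the point where [v] has landed goes to [b]. *)
  pose t := (tperm u a * tperm (tperm u a v) b)%g.
  have tu : t u = a.
    rewrite permM tpermL tpermD // 1?eq_sym //.
    by apply: contraNneq uv => e; rewrite -[v](tpermK u a) -e tpermR.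
  have tv : t v = b by rewrite permM tpermL.
  rewrite mulr1n /N /mean [in RHS](reindex_inj (mulgI t)); congr (_ / _).
  by apply: eq_bigr => p _; rewrite !(permM t) tu tv.
have T2 : (1 < #|T|)%N.
  by rewrite -cardsT (cardD1 u) inE (cardD1 v) !inE eq_sym uv.
have T0 : (0 < #|T|)%N by exact: ltnW.
apply: (@mulIf _ (#|T|%:R * #|T|.-1%:R)).
  by rewrite mulf_neq0 // pnatr_eq0 -lt0n // -subn1 subn_gt0.
rewrite mulfVK; last by rewrite mulf_neq0 // pnatr_eq0 -lt0n // -subn1 subn_gt0.
rewrite -/(N u v) -natrM mulr_natr.
have <- : \sum_a \sum_b N a b = N u v *+ (#|T| * #|T|.-1).
  rewrite (eq_bigr (fun=> N u v *+ #|T|.-1)).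
    by rewrite sumr_const -mulrnA mulnC.
  move=> a _; under eq_bigr do rewrite NE.
  rewrite sumrMnr; congr (_ *+ _).
  rewrite -(cardC1 a) -sum1_card [RHS]big_mkcond /=; apply: eq_bigr => b _.
  by rewrite !inE eq_sym; case: (_ == _).
rewrite -natrM.
under eq_bigr do rewrite -mulr_suml exchange_big.
rewrite -mulr_suml exchange_big /=.
apply: etrans (mean_cst _ card_perm_gt0); congr (_ / _); apply: eq_bigr => p _.
under eq_bigr do rewrite -natr_sum.
rewrite -natr_sum; congr _%:R.
rewrite -(sum_perm_mem X p) big_distrl; apply: eq_bigr => a _.
rewrite -(sum_perm_mem Y p) big_distrr; apply: eq_bigr => b _.
by rewrite -mulnb.
Qed.

(* Averaging over S_n first replaces F by its mean over each orbit. *)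
Lemma sum_invariant_le {I : finType} (P : pred I) (act : {perm T} -> I -> I)
    (F : I -> R) (B : R) :
  (forall p, injective (act p)) -> (forall p i, P (act p i) = P i) ->
  (forall i, P i -> mean predT (fun p => F (act p i)) <= B) ->
  \sum_(i | P i) F i <= #|P|%:R * B.
Proof.
move=> actI actP FB.
have N0 : 0 < #|{: {perm T}}|%:R :> R by rewrite ltr0n card_perm_gt0.
rewrite -(ler_pM2r N0) [leLHS]mulr_natr -sumr_const.
have -> : \sum_(p : {perm T}) \sum_(i | P i) F i =
    \sum_(i | P i) \sum_p F (act p i).
  rewrite [RHS]exchange_big /=; apply: eq_bigr => p _.
  by rewrite (reindex_inj (actI p)); apply: eq_bigl => i; rewrite actP.
apply: (@le_trans _ _ (\sum_(i | P i) (#|{: {perm T}}|%:R * B))).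
  by apply: ler_sum => i Pi; rewrite (meanE _ card_perm_gt0) ler_pM2l // FB.
by rewrite sumr_const -mulr_natl le_eqVlt; apply/orP; left; apply/eqP; ring.
Qed.

End PairSums.

(** * Edges between X and Y contributed by one permutation or matching *)

Section Crossing.
Context {T : finType}.
Implicit Types (X Y : {set T}) (i k u v : T) (p s c : {perm T}).
Implicit Types (M : {set {set T}}).

Definition crossing X Y i k : bool :=
  (i \in X) && (k \in Y) || (i \in Y) && (k \in X).

Lemma crossing_natE X Y i k : (X :&: Y = finset.set0)%SET ->
  (crossing X Y i k : nat) =
  ((i \in X) && (k \in Y) + (i \in Y) && (k \in X))%N.
Proof.
move=> XY; rewrite /crossing; have := finset.in_set0 i; rewrite -XY inE.
by case: (i \in X); case: (i \in Y) => //= _; rewrite ?orbF ?addn0.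
Qed.

Lemma sum_mem_eq X i : (\sum_(x in X) (i == x))%N = (i \in X).
Proof.
have [iX|iX] := boolP (i \in X).
  rewrite (bigD1 i) //= eqxx big1 // => x /andP[_].
  by rewrite eq_sym => /negbTE ->.
by rewrite big1 // => x xX; case: eqP xX iX => // -> ->.
Qed.

Lemma sum_eq i : (\sum_x (i == x))%N = 1%N.
Proof.
by have := sum_mem_eq [set: T]%SET i; rewrite inE; under eq_bigl do rewrite inE.
Qed.

(** The two ways of matching the endpoints exclude each other when [x != y], so the disjunction
    becomes a sum of products, which factors under a double sum over [x] and [y]. *)
Lemma set2_eqE i k x y : x != y ->
  (([set i; k] == [set x; y])%SET : nat) =
  ((i == x) * (k == y) + (k == x) * (i == y))%N.
Proof.
move=> xy; rewrite finset.eqEsubset !finset.subUset !finset.sub1set !inE.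
rewrite !(eq_sym x) !(eq_sym y).
have [->|ix] := eqVneq i x; have [->|kx] := eqVneq k x;
  rewrite ?(negbTE xy) ?(eq_sym _ x) ?(negbTE xy) /= ?orbF ?andbF ?andbT //=;
  by case: (_ == _) => //; case: (_ == _).
Qed.

Lemma sum_set2_eq X Y i k : (X :&: Y = finset.set0)%SET ->
  (\sum_(x in X) \sum_(y in Y) ([set i; k] == [set x; y])%SET)%N =
  crossing X Y i k.
Proof.
move=> XY; rewrite crossing_natE // -!mulnb.
transitivity (\sum_(x in X) \sum_(y in Y)
    ((i == x) * (k == y) + (k == x) * (i == y)))%N.
  apply: eq_bigr => x xX; apply: eq_bigr => y yY; apply: set2_eqE.
  apply: contraTneq yY => <-.
  by have := finset.in_set0 x; rewrite -XY inE xX => /= ->.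
under eq_bigr do rewrite big_split /= -!big_distrr /= !sum_mem_eq.
by rewrite big_split /= -!big_distrl /= !sum_mem_eq [((k \in X) * _)%N]mulnC.
Qed.

Definition perm_crossings X Y s : nat := (\sum_i crossing X Y i (s i))%N.

Definition matching_crossings X Y M : nat :=
  (\sum_(x in X) \sum_(y in Y) ([set x; y] \in M)%SET)%N.

(** Conjugation by [p] carries the edge from [u] to [c u] to the edge from [p u] to [p (c u)]. *)
Lemma perm_crossings_conj X Y c p :
  perm_crossings X Y (c ^ p)%g =
  pair_sum (fun u v => c u == v) (fun _ i _ j => crossing X Y i j) p.
Proof.
rewrite /perm_crossings /pair_sum (reindex_inj (@perm_inj _ p)).
apply: eq_bigr => u _; rewrite permJ (bigD1 (c u)) //= eqxx big1 ?addn0 // => v.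
by rewrite eq_sym => /negbTE ->.
Qed.

Lemma matching_crossings_image X Y M p :
  matching_crossings X Y [set p @: (e : {set T}) | e in M]%SET =
  pair_sum (fun u v => [set u; v] \in M)%SET
    (fun _ i _ j => (i \in X) && (j \in Y)) p.
Proof.
rewrite /matching_crossings /pair_sum big_mkcond (reindex_inj (@perm_inj _ p)).
apply: eq_bigr => u _; case: (p u \in X); last first.
  by rewrite big1 // => v _; rewrite andbF.
rewrite big_mkcond (reindex_inj (@perm_inj _ p)); apply: eq_bigr => v _ /=.
have -> : ([set p u; p v] = p @: [set u; v])%SET.
  by rewrite imsetU1 imset_set1.
rewrite mem_imset; last by apply: imset_inj; exact: perm_inj.
by case: (_ \in Y); rewrite ?andbT ?andbF.
Qed.

End Crossing.

(** * Matchings and full cycles under relabelling of vertices *)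

Section Matchings.
Context {n : nat}.
Implicit Types (M : {set {set 'I_n}}) (p c : 'S_n) (u v : 'I_n).

Lemma matching_edge_card M u v : matching M -> [set u; v]%SET \in M -> u != v.
Proof.
move=> /andP[_ /forall_inP h] /h; rewrite cards2; by case: (_ != _).
Qed.

(** Edges are disjoint, so a covered vertex lies in exactly one; the term [v = u] vanishes because
    an edge has two elements. This gives both the row bounds and the mean for a matching. *)
Lemma sum_matching_row M u : matching M ->
  (\sum_v ([set u; v] \in M)%SET)%N = (u \in finset.cover M).
Proof.
move=> mM; have /andP[tM /forall_inP cM] := mM.
have [/finset.bigcupP[e eM ue]|uM] := boolP (u \in _).
  have /cards2P[x [y [xy Ee]]] := cM _ eM.
  have [v Ev] : exists v, e = [set u; v]%SET.
    move: ue; rewrite Ee !inE => /orP[] /eqP ->; first by exists y.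
    by exists x; rewrite finset.setUC.
  rewrite (bigD1 v) //= -Ev eM big1 // => w wv.
  case: (boolP (_ \in M)) => // wM; have uw := matching_edge_card mM wM.
  have := finset.trivIsetP tM _ _ eM wM; case: eqP => [Ew _|_ /(_ isT)].
    have : w \in e by rewrite Ew !inE eqxx orbT.
    by rewrite Ev !inE (negbTE wv) orbF eq_sym (negbTE uw).
  by rewrite disjoint_subset => /fintype.subsetP/(_ u ue); rewrite !inE eqxx.
rewrite big1 // => v _; case: (boolP (_ \in M)) => // eM.
by case/negP: uM; apply/finset.bigcupP; exists [set u; v]%SET => //; rewrite !inE eqxx.
Qed.

Lemma matching_image M p :
  matching [set p @: (e : {set _}) | e in M]%SET = matching M.
Proof.
rewrite /matching (imset_trivIset _ (@perm_inj _ p)); congr (_ && _).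
apply/forall_inP/forall_inP => h e eM.
  have := h (p @: e)%SET (imset_f _ eM).
  by rewrite card_imset //; exact: perm_inj.
case/imsetP: eM => e' e'M ->; rewrite card_imset; first exact: h.
exact: perm_inj.
Qed.

Lemma cover_image M p :
  finset.cover [set p @: (e : {set _}) | e in M]%SET = (p @: finset.cover M)%SET.
Proof. by rewrite cover_imset -imset_cover. Qed.

Lemma perfect_matching_image M p :
  perfect_matching [set p @: (e : {set _}) | e in M]%SET = perfect_matching M.
Proof.
(* Covering all vertices is a statement about cardinality, which an injective image preserves. *)
have cT N : (finset.cover N == [set: 'I_n]%SET) = (#|finset.cover N| == n).
  rewrite eqEcard finset.subsetT cardsT card_ord eqn_leq /=.
  by have := max_card (mem (finset.cover N)); rewrite card_ord => ->.
rewrite /perfect_matching matching_image !cT cover_image card_imset //.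
exact: perm_inj.
Qed.

Lemma near_perfect_matching_image M p :
  near_perfect_matching [set p @: (e : {set _}) | e in M]%SET =
  near_perfect_matching M.
Proof.
have cC (A : {set 'I_n}) : #|(~: A)%SET| = (#|'I_n| - #|A|)%N.
  by rewrite cardsCs finset.setCK.
rewrite /near_perfect_matching matching_image cover_image !cC.
by rewrite card_imset //; exact: perm_inj.
Qed.

(** The orbits of [c ^ p] are the images under [p] of the orbits of [c], so there are equally
    many. *)
Lemma full_cycle_conj c p : full_cycle (c ^ p)%g = full_cycle c.
Proof.
rewrite /full_cycle; have porbitJ x : porbit (c ^ p)%g (p x) = (p @: porbit c x)%SET.
  apply/finset.setP => y; apply/porbitP/imsetP => [[i ->]|[z /porbitP[i ->] ->]].
    by exists ((c ^+ i)%g x); rewrite ?mem_porbit // -conjXg permJ.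
  by exists i; rewrite -conjXg permJ.
have -> : porbits (c ^ p)%g = [set p @: (B : {set _}) | B in porbits c]%SET.
  apply/finset.setP => B; apply/imsetP/imsetP => [[x _ ->]|[A /imsetP[x _ ->] ->]].
    by exists (porbit c ((p^-1)%g x)); rewrite ?imset_f // -porbitJ permKV.
  by exists (p x) => //; rewrite porbitJ.
by rewrite card_imset //; apply: imset_inj; exact: perm_inj.
Qed.

(** A fixed point would be the whole of the only orbit, forcing [n = 1]. Thus [u] and [c u] are
    distinct, as the formula for the mean of a pair requires. *)
Lemma full_cycle_moves c u : (1 < n)%N -> full_cycle c -> c u != u.
Proof.
move=> n1 /cards1P[B EB]; apply: contraTneq n1 => cu.
have uB x : porbit c x = B.
  by apply/finset.set1P; rewrite -EB; apply: imset_f.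
have xu x : x = u.
  have := porbit_id c x; rewrite uB -(uB u) => /porbitP[i ->].
  by elim: i => [|i IH]; rewrite ?expg0 ?perm1 // expgSr permM IH.
rewrite -leqNgt -[n]card_ord -cardsT.
apply: leq_trans (subset_leq_card _) (_ : #|[set u]%SET| <= 1)%N.
  by apply/fintype.subsetP => x _; rewrite (xu x) finset.set11.
by rewrite cards1.
Qed.

End Matchings.

(** * Exponential moments for a single permutation, cycle or matching *)

Section ModelMgf.
Context {R : realType} {n : nat}.
Implicit Types (X Y : {set 'I_n}) (th : R).

(** [w] is the degree that one random piece adds at a vertex: 2 for a permutation, 1 for a matching.
    Then [w |X| |Y| / n] bounds the mean number of crossing edges from below. *)
Definition mgf_bound (w : nat) X Y th : R :=
  expR (- th * (w%:R * (#|X|%:R * #|Y|%:R / n%:R)) + 128 * th ^+ 2 * n%:R).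

(** Here the permutation is the random object, so the relation is equality. Each image is uniform,
    and the mean is exactly [2 |X| |Y| / n]. *)
Lemma perm_crossings_mgf X Y th : (X :&: Y = finset.set0)%SET ->
  0 <= th <= 1 / 16 ->
  \sum_(s : 'S_n) expR (- th * (perm_crossings X Y s)%:R) <=
  #|{: 'S_n}|%:R * mgf_bound 2 X Y th.
Proof.
move=> XY th01; rewrite (meanE _ card_perm_gt0) ler_wpM2l //.
pose m := [rel u v : 'I_n | u == v].
pose phi (u _ _ j : 'I_n) := crossing X Y u j.
have E s : perm_crossings X Y s = pair_sum m phi s.
  apply: eq_bigr => u _; rewrite (bigD1 u) //= eqxx big1 ?addn0 // => v.
  by rewrite eq_sym => /negbTE ->.
have -> : (fun s => expR (- th * (perm_crossings X Y s)%:R)) =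
    (fun s => expR (- th * (pair_sum m phi s)%:R)).
  by apply/funext => s; rewrite E.
rewrite /mgf_bound -[X in 128 * _ * X%:R]card_ord; apply: pair_sum_mgf => //.
- by move=> u; rewrite /= sum_eq.
- by move=> v; under eq_bigr do rewrite /= eq_sym; rewrite sum_eq.
have -> : (fun s => (pair_sum m phi s)%:R) = (fun s : 'S_n =>
    \sum_u ((u \in X)%:R * (s u \in Y)%:R + (u \in Y)%:R * (s u \in X)%:R) : R).
  apply/funext => s; rewrite -E natr_sum; apply: eq_bigr => u _.
  by rewrite crossing_natE // natrD -!mulnb !natrM.
rewrite /mean exchange_big mulr_suml /=.
under eq_bigr do rewrite -[_ / _]/(mean predT _) meanD !meanZ !mean_mem card_ord.
rewrite big_split /= -!mulr_suml -!natr_sum.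
have cE (Z : {set 'I_n}) : (\sum_i (i \in Z))%N = #|Z|.
  by rewrite -(sum_perm_mem Z 1%g); apply: eq_bigr => i _; rewrite perm1.
by rewrite !cE le_eqVlt; apply/orP; left; apply/eqP; ring.
Qed.

Lemma cycle_crossings_mgf X Y th : (X :&: Y = finset.set0)%SET ->
  (1 < n)%N -> 0 <= th <= 1 / 16 ->
  \sum_(c : 'S_n | full_cycle c) expR (- th * (perm_crossings X Y c)%:R) <=
  #|[pred c : 'S_n | full_cycle c]|%:R * mgf_bound 2 X Y th.
Proof.
move=> XY n1 th01.
apply: (@sum_invariant_le R _ _ (@full_cycle n) (fun p c => (c ^ p)%g)
  (fun c => expR (- th * (perm_crossings X Y c)%:R))).
- by move=> p; apply: conjg_inj.
- by move=> p c; apply: full_cycle_conj.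
move=> c fc; have cu u := full_cycle_moves u n1 fc.
pose m := [rel u v : 'I_n | c u == v].
pose phi (_ i _ j : 'I_n) := crossing X Y i j.
have -> : (fun p => expR (- th * (perm_crossings X Y (c ^ p)%g)%:R)) =
    (fun p => expR (- th * (pair_sum m phi p)%:R)).
  by apply/funext => p; rewrite perm_crossings_conj.
rewrite /mgf_bound -[X in 128 * _ * X%:R]card_ord; apply: pair_sum_mgf => //.
- by move=> u; rewrite /= sum_eq.
- move=> v; rewrite (reindex_inj (@perm_inj _ c^-1%g)).
  by under eq_bigr do rewrite /= permKV eq_sym; rewrite sum_eq.
have -> : (fun p => (pair_sum m phi p)%:R) = (fun p : 'S_n =>
    \sum_u (((p u \in X) && (p (c u) \in Y))%:R +
            ((p u \in Y) && (p (c u) \in X))%:R) : R).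
  apply/funext => p; rewrite -perm_crossings_conj /perm_crossings.
  rewrite (reindex_inj (@perm_inj _ p)) natr_sum; apply: eq_bigr => u _.
  by rewrite permJ crossing_natE // natrD.
have YX : (Y :&: X = finset.set0)%SET by rewrite finset.setIC.
rewrite /mean exchange_big mulr_suml /=.
under eq_bigr => u _.
  rewrite -[_ / _]/(mean predT _) meanD (mean_pair XY) 1?eq_sym //.
  rewrite (mean_pair YX) 1?eq_sym // card_ord; over.
rewrite sumr_const card_ord.
have n0 : 0 < n%:R :> R by rewrite ltr0n ltnW.
have n10 : 0 < n.-1%:R :> R by rewrite ltr0n -subn1 subn_gt0.
(* The mean over conjugates is [2 |X| |Y| / (n - 1)], slightly above the required value. *)
have -> : (#|X|%:R * #|Y|%:R / (n%:R * n.-1%:R) +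
    #|Y|%:R * #|X|%:R / (n%:R * n.-1%:R)) *+ n =
    2 * (#|X|%:R * #|Y|%:R / n.-1%:R) :> R.
  by rewrite -[LHS]mulr_natr; field; rewrite !gt_eqF.
rewrite ler_wpM2l // ler_wpM2l ?mulr_ge0 // lef_pV2 ?posrE //.
by rewrite ler_nat leq_pred.
Qed.

(** Perfect and near-perfect matchings are treated together. Each covered vertex starts one ordered
    pair, which lands in [X] times [Y] with probability [|X| |Y| / (n (n - 1))]; [n - 1] covered
    vertices are enough for a mean of [|X| |Y| / n]. *)
Lemma matching_crossings_mgf (P : pred {set {set 'I_n}}) X Y th :
  (forall (p : 'S_n) (M : {set {set 'I_n}}), P [set p @: (e : {set _}) | e in M]%SET = P M) ->
  (forall M, P M -> matching M && (n.-1 <= #|finset.cover M|)%N) ->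
  (X :&: Y = finset.set0)%SET -> (1 < n)%N -> 0 <= th <= 1 / 16 ->
  \sum_(M | P M) expR (- th * (matching_crossings X Y M)%:R) <=
  #|P|%:R * mgf_bound 1 X Y th.
Proof.
move=> invP PM XY n1 th01.
apply: (@sum_invariant_le R _ _ P
  (fun p M => [set p @: (e : {set _}) | e in M]%SET)
  (fun M => expR (- th * (matching_crossings X Y M)%:R))) => //.
  by move=> p; apply: imset_inj; apply: imset_inj; exact: perm_inj.
move=> M /PM /andP[mM cM].
pose m := [rel u v : 'I_n | [set u; v]%SET \in M].
pose phi (_ i _ j : 'I_n) := (i \in X) && (j \in Y).
have -> : (fun p : 'S_n => expR (- th *
      (matching_crossings X Y [set p @: (e : {set _}) | e in M]%SET)%:R)) =
    (fun p => expR (- th * (pair_sum m phi p)%:R)).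
  by apply/funext => p; rewrite matching_crossings_image.
have row u : (\sum_v m u v)%N = (u \in finset.cover M) := sum_matching_row u mM.
rewrite /mgf_bound -[X in 128 * _ * X%:R]card_ord; apply: pair_sum_mgf => //.
- by move=> u; rewrite row leq_b1.
- move=> v; under eq_bigr do rewrite /= finset.setUC.
  by rewrite [leqLHS]row leq_b1.
have n0 : 0 < n%:R :> R by rewrite ltr0n ltnW.
have n10 : 0 < n.-1%:R :> R by rewrite ltr0n -subn1 subn_gt0.
have -> : (fun p => (pair_sum m phi p)%:R) = (fun p : 'S_n =>
    \sum_u \sum_v (m u v)%:R * ((p u \in X) && (p v \in Y))%:R : R).
  apply/funext => p; rewrite natr_sum; apply: eq_bigr => u _.
  by rewrite natr_sum; apply: eq_bigr => v _; rewrite -natrM mulnb.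
rewrite /mean exchange_big mulr_suml /=.
have -> : \sum_u (\sum_(p : 'S_n) \sum_v
      (m u v)%:R * ((p u \in X) && (p v \in Y))%:R) / #|{: 'S_n}|%:R =
    \sum_u (\sum_v m u v)%N%:R * (#|X|%:R * #|Y|%:R / (n%:R * n.-1%:R)) :> R.
  apply: eq_bigr => u _; rewrite exchange_big mulr_suml natr_sum mulr_suml.
  apply: eq_bigr => v _; rewrite -[LHS]/(mean predT _) meanZ.
  have [uvM|] := boolP (m u v); last by rewrite !mul0r.
  by rewrite (mean_pair XY) ?card_ord // (matching_edge_card mM).
rewrite -mulr_suml -natr_sum.
have -> : (\sum_u \sum_v m u v)%N = #|finset.cover M|.
  by rewrite -(sum_perm_mem _ 1%g); apply: eq_bigr => u _; rewrite row perm1.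
rewrite mul1r.
rewrite (_ : _ / n%:R = n.-1%:R * (#|X|%:R * #|Y|%:R / (n%:R * n.-1%:R))).
  by rewrite ler_wpM2r ?ler_nat // mulr_ge0 ?invr_ge0 ?mulr_ge0.
by field; rewrite !gt_eqF.
Qed.

End ModelMgf.

(** * Union bound over pairs of vertex sets *)

Section UnionBound.
Context {R : realType} {T : finType} {n r d k w : nat}.
Context (G : {ffun 'I_r -> T} -> mgraph n).
Context (e : T -> {set 'I_n} -> {set 'I_n} -> nat).
Implicit Types (X Y : {set 'I_n}).

(** One argument for all models: [r] independent pieces of degree [w]. Large [X] and [Y] have mean
    crossing number at least [d n / s^2], twice the threshold, and there are at most [4^n] pairs. *)
Lemma uniform_law_bad_le (s th : R) :
  s = 6 * 3 ^ (k%:Z - 2) -> (0 < n)%N -> (0 < w)%N -> (r * w = d)%N -> 0 <= th ->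
  (forall W X Y, (X :&: Y = finset.set0)%SET ->
    edges_between (G W) X Y = \sum_j e (W j) X Y)%N ->
  (forall X Y, (X :&: Y = finset.set0)%SET -> (0 < #|X|)%N -> (0 < #|Y|)%N ->
    \sum_t expR (- th * (e t X Y)%:R) <= #|T|%:R * mgf_bound w X Y th) ->
  (uniform_law G (~` [set g | many_edges_between R k d g]) <=
    ((4 * expR (d%:R * (128 * th ^+ 2 - th / (2 * s ^+ 2)))) ^+ n)%:E)%E.
Proof.
move=> sE n0 w0 rw th0 GE mgf.
have s0 : 0 < s by rewrite sE mulr_gt0 // exprz_gt0.
have nR0 : 0 < n%:R :> R by rewrite ltr0n.
set B := 4 * _.
have B0 : 0 <= B by rewrite mulr_ge0 ?expR_ge0.
rewrite /uniform_law lee_fin.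
(* On an empty sample space division by zero makes the law zero. *)
have [N0|N0] := posnP #|{ffun 'I_r -> T}|.
  by rewrite N0 invr0 mulr0 exprn_ge0.
rewrite ler_pdivrMr ?ltr0n //.
pose ok (q : {set 'I_n} * {set 'I_n}) := [&& q.1 :&: q.2 == finset.set0,
  n%:R / s <= #|q.1|%:R :> R & n%:R / s <= #|q.2|%:R :> R]%SET.
pose thr : R := d%:R * n%:R / (2 * s ^+ 2).
(* Markov's inequality for expR (th * (thr - edges)). *)
pose tilt W q := expR (th * thr - th * (edges_between (G W) q.1 q.2)%:R).
apply: (@le_trans _ _ (\sum_W \sum_(q | ok q) tilt W q)).
  rewrite -sum1_card natr_sum big_mkcond; apply: ler_sum => W _.
  have tilt0 : 0 <= \sum_(q | ok q) tilt W q.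
    by apply: sumr_ge0 => q _; apply: expR_ge0.
  case: ifP => //; rewrite !inE /= => /existsNP[X] /existsNP[Y].
  rewrite -sE => /not_implyP[XY] /not_implyP[hX] /not_implyP[hY] /negP.
  rewrite -ltNge => hlt.
  rewrite (bigD1 (X, Y)) /=; last by rewrite /ok /= XY eqxx hX hY.
  rewrite -[leLHS]addr0; apply: lerD; last first.
    by apply: sumr_ge0 => q _; apply: expR_ge0.
  by rewrite -expR0 ler_expR subr_ge0 ler_wpM2l // ltW.
have mgfB q : ok q ->
    \sum_W tilt W q <= #|{ffun 'I_r -> T}|%:R * (B / 4) ^+ n.
  case: q => X Y /and3P[/= /eqP XY hX hY].
  have pos Z : n%:R / s <= #|Z|%:R :> R -> (0 < #|Z|)%N.
    by move=> h; rewrite -(ltr0n R); apply: lt_le_trans h; rewrite divr_gt0.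
  (* Independence: the sum over all choices of a product over the pieces is a power of the sum for
     one piece. *)
  have -> : \sum_W tilt W (X, Y) =
      expR (th * thr) * (\sum_t expR (- th * (e t X Y)%:R)) ^+ r.
    rewrite -[X in _ ^+ X]card_ord -prodr_const bigA_distr_bigA mulr_sumr.
    apply: eq_bigr => W _; rewrite /tilt expRD GE // -expR_sum natr_sum.
    by congr (_ * expR _); rewrite -mulNr mulr_sumr.
  apply: (@le_trans _ _
    (expR (th * thr) * (#|T|%:R * mgf_bound w X Y th) ^+ r)).
    rewrite ler_wpM2l ?expR_ge0 // lerXn2r ?nnegrE ?mgf ?pos //.
      by apply: sumr_ge0 => t _; apply: expR_ge0.
    by rewrite mulr_ge0 ?expR_ge0.
  rewrite card_ffun card_ord natrX exprMn mulrCA ler_wpM2l ?exprn_ge0 //.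
  have -> : B / 4 = expR (d%:R * (128 * th ^+ 2 - th / (2 * s ^+ 2))).
    by rewrite /B mulrC mulKf.
  rewrite /mgf_bound -!expRM_natl -expRD ler_expR.
  have hA : n%:R / s ^+ 2 <= #|X|%:R * #|Y|%:R / n%:R :> R.
    have -> : n%:R / s ^+ 2 = n%:R / s * (n%:R / s) / n%:R :> R.
      by field; rewrite !gt_eqF.
    by rewrite ler_wpM2r ?invr_ge0 // ler_pM // divr_ge0 // ltW.
  (* The threshold adds [th d q / 2] to the exponent and the mean removes at least [th d q]; the
     quadratic errors of the [r <= d] pieces remain. *)
  set A := _ / n%:R in hA *; pose q : R := n%:R / s ^+ 2.
  have h1 : th * d%:R * q <= th * d%:R * A by rewrite ler_wpM2l // mulr_ge0.
  have h2 : r%:R * (128 * th ^+ 2 * n%:R) <= d%:R * (128 * th ^+ 2 * n%:R) :> R.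
    by rewrite ler_wpM2r ?mulr_ge0 ?sqr_ge0 // ler_nat -rw leq_pmulr.
  have -> : th * thr = th * d%:R * q / 2 by rewrite /thr /q; field; rewrite gt_eqF.
  have -> : n%:R * (d%:R * (128 * th ^+ 2 - th / (2 * s ^+ 2))) =
      d%:R * (128 * th ^+ 2 * n%:R) - th * d%:R * q / 2 :> R.
    by rewrite /q; field; rewrite gt_eqF.
  have -> : r%:R * (- th * (w%:R * A) + 128 * th ^+ 2 * n%:R) =
      r%:R * (128 * th ^+ 2 * n%:R) - th * d%:R * A :> R.
    by rewrite -rw natrM; ring.
  lra.
rewrite exchange_big /=.
apply: le_trans (ler_sum _ mgfB) _.
rewrite sumr_const -[leLHS]mulr_natl.
have c4 : (#|ok|%:R : R) <= 4 ^+ n.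
  have -> : (4 : R) ^+ n = #|{: {set 'I_n} * {set 'I_n}}|%:R.
    rewrite card_prod -cardsT -powersetT card_powerset cardsT card_ord.
    by rewrite natrM natrX -exprMn -natrM.
  by rewrite ler_nat max_card.
have -> : B ^+ n = 4 ^+ n * (B / 4) ^+ n by rewrite -exprMn mulrC divfK.
rewrite mulrCA [leRHS]mulrC ler_wpM2l // ler_wpM2r //.
by rewrite exprn_ge0 // divr_ge0.
Qed.

End UnionBound.

(** * The four models as instances of the union bound *)

Lemma edges_perm_graph n r (s : 'I_r -> 'S_n) (X Y : {set 'I_n}) :
  (X :&: Y = finset.set0)%SET ->
  (edges_between (perm_graph s) X Y = \sum_j perm_crossings X Y (s j))%N.
Proof.
move=> XY; rewrite /edges_between /perm_crossings [RHS]pair_big /=.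
transitivity (\sum_(x in X) \sum_(y in Y)
    \sum_(p : 'I_r * 'I_n) ([set p.2; s p.1 p.2] == [set x; y])%SET)%N.
  apply: eq_bigr => x _; apply: eq_bigr => y _.
  rewrite /mult /= ffunE /perm_mult -sum1_card [LHS]big_mkcond.
  by apply: eq_bigr => p _; rewrite inE; case: (_ == _).
under eq_bigr do rewrite exchange_big.
by rewrite exchange_big; apply: eq_bigr => p _; rewrite sum_set2_eq.
Qed.

Lemma edges_matching_graph n r (M : 'I_r -> {set {set 'I_n}}) (X Y : {set 'I_n}) :
  (edges_between (matching_graph M) X Y = \sum_j matching_crossings X Y (M j))%N.
Proof.
rewrite /edges_between /matching_crossings.
transitivity (\sum_(x in X) \sum_(y in Y) \sum_j ([set x; y] \in M j)%SET)%N.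
  apply: eq_bigr => x _; apply: eq_bigr => y _.
  rewrite /mult /= ffunE /matching_mult -sum1_card [LHS]big_mkcond.
  by apply: eq_bigr => p _; rewrite inE; case: (_ \in _).
under eq_bigr do rewrite exchange_big.
by rewrite exchange_big.
Qed.

Lemma sum_sig_le {R : realType} {I : finType} (P : pred I) (F : I -> R) (B : R) :
  \sum_(i | P i) F i <= #|[pred i | P i]|%:R * B ->
  \sum_(x : {i | P i}) F (val x) <= #|{: {i | P i}}|%:R * B.
Proof.
by rewrite card_sig; congr (_ <= _); rewrite (big_sub P F).
Qed.

(** This excludes [n = 1], where a full cycle has a fixed point and the divisor [n - 1] vanishes. *)
Lemma disjoint_nonempty_gt1 n (X Y : {set 'I_n}) :
  (X :&: Y = finset.set0)%SET -> (0 < #|X|)%N -> (0 < #|Y|)%N -> (1 < n)%N.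
Proof.
move=> XY X0 Y0; rewrite -[n]card_ord.
apply: leq_trans (max_card (mem (X :|: Y)%SET)).
by rewrite cardsU XY cards0 subn0 (leq_add X0 Y0).
Qed.

Lemma model_law_bad_le {R : realType} (m : model) (k d n : nat) (s th : R) :
  s = 6 * 3 ^ (k%:Z - 2) -> model_defined m d n -> 0 <= th <= 1 / 16 ->
  (model_law R m d n (~` [set g | many_edges_between R k d g]) <=
    ((4 * expR (d%:R * (128 * th ^+ 2 - th / (2 * s ^+ 2)))) ^+ n)%:E)%E.
Proof.
move=> sE /andP[n0 mdef] th01; have /andP[th0 _] := th01.
case: m mdef => [dE|dE|nE|nE] /=.
- have d2 : (d./2 * 2 = d)%N by rewrite muln2 even_halfK.
  apply: (uniform_law_bad_le (w := 2)
    (e := fun t X Y => perm_crossings X Y t) sE) => //.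
    by move=> W X Y XY; rewrite edges_perm_graph.
  by move=> X Y XY _ _; apply: perm_crossings_mgf.
- have d2 : (d./2 * 2 = d)%N by rewrite muln2 even_halfK.
  apply: (uniform_law_bad_le (w := 2)
    (e := fun t X Y => perm_crossings X Y (val t)) sE) => //.
    by move=> W X Y XY; rewrite edges_perm_graph.
  move=> X Y XY X0 Y0.
  apply: (@sum_sig_le R _ _ (fun c => expR (- th * (perm_crossings X Y c)%:R))).
  by apply: cycle_crossings_mgf => //; apply: disjoint_nonempty_gt1 XY X0 Y0.
- apply: (uniform_law_bad_le (w := 1)
    (e := fun t X Y => matching_crossings X Y (val t)) sE) => //.
  + exact: muln1.
  + by move=> W X Y XY; rewrite edges_matching_graph.
  move=> X Y XY X0 Y0.
  apply: (@sum_sig_le R _ _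
    (fun M => expR (- th * (matching_crossings X Y M)%:R))).
  apply: matching_crossings_mgf => //; last exact: disjoint_nonempty_gt1 XY X0 Y0.
    by move=> p M; apply: perfect_matching_image.
  by move=> M /andP[-> /eqP ->]; rewrite cardsT card_ord leq_pred.
- apply: (uniform_law_bad_le (w := 1)
    (e := fun t X Y => matching_crossings X Y (val t)) sE) => //.
  + exact: muln1.
  + by move=> W X Y XY; rewrite edges_matching_graph.
  move=> X Y XY X0 Y0.
  apply: (@sum_sig_le R _ _
    (fun M => expR (- th * (matching_crossings X Y M)%:R))).
  apply: matching_crossings_mgf => //; last exact: disjoint_nonempty_gt1 XY X0 Y0.
    by move=> p M; apply: near_perfect_matching_image.
  move=> M /andP[-> /eqP h] /=.
  have := cardsC (finset.cover M); rewrite h addn1 card_ord => E.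
  by rewrite -[X in (X.-1 <= _)%N]E.
Qed.

(** * Choice of the constants and passage to the limit *)

Theorem theorem4 (R : realType) (k : nat) (hk : (1 <= k)%N) :
  exists c0 : nat, forall d : nat, (c0 <= d)%N ->
  forall (m : model) (L : forall n, probability (mgraph n) R),
  let D := [set n | model_defined m d n] in
  (forall n, D n -> L n [set g | regular d g] = 1%E) ->
  dominates D (model_law R m d) L ->
  whp D L (fun n g => many_edges_between R k d g).
Proof.
pose s : R := 6 * 3 ^ (k%:Z - 2).
have s0 : 0 < s by rewrite mulr_gt0 // exprz_gt0.
have s2 : 1 <= s.
  (* For [k >= 1] the shifted exponent is non-negative, which also handles the negative exponent at
     [k = 1]. *)
  have -> : s = 2 * 3 ^ (k%:Z - 1).
    have -> : k%:Z - 1 = k%:Z - 2 + 1 by ring.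
    by rewrite expfzDr // expr1z /s; ring.
  have : (1 : R) <= 3 ^ (k%:Z - 1).
    case: k hk {s s0} => // k _.
    by rewrite intS addrC addKr -exprnP exprn_ege1 // ler1n.
  lra.
pose x := (s ^+ 2)^-1; have x0 : 0 < x by rewrite invr_gt0 exprn_gt0.
have x1 : x <= 1 by rewrite invf_le1 ?exprn_gt0 // exprn_ege1.
(* This [th] minimises [128 th^2 - th / (2 s^2)], and the minimum is [- kappa]. *)
pose th := x / 512; pose kappa := x ^+ 2 / 2048.
have kappa0 : 0 < kappa by have := exprn_gt0 2 x0; rewrite /kappa; lra.
have th01 : 0 <= th <= 1 / 16 by apply/andP; split; rewrite /th; lra.
have kappaE : 128 * th ^+ 2 - th / (2 * s ^+ 2) = - kappa.
  by rewrite /kappa /th /x; field; rewrite gt_eqF.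
(* With [d kappa >= 8] the exponential of [d kappa] is at least 9, which beats the factor 4 from the
   union bound and makes [rho < 1]. *)
have [c0 hc0] : exists c0 : nat, 8 <= c0%:R * kappa.
  exists (Num.bound (8 / kappa)); rewrite -ler_pdivrMr //.
  by rewrite ltW // archi_boundP // divr_ge0 // ltW.
exists c0 => d cd m L D _ dom.
pose rho := 4 * expR (d%:R * - kappa).
have rho0 : 0 <= rho by rewrite mulr_ge0 ?expR_ge0.
have rho1 : rho < 1.
  have dk : 8 <= d%:R * kappa.
    by apply: le_trans hc0 _; rewrite ler_wpM2r ?ler_nat // ltW.
  have : 9 <= expR (d%:R * kappa) by have := expR_ge1Dx (d%:R * kappa); lra.
  rewrite /rho mulrN expRN => h; rewrite ltr_pdivrMr ?expR_gt0 //; lra.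
(* Domination transfers only probabilities tending to 0, so it is applied to the complementary
   event, whose model probability is at most [rho ^+ n]. *)
pose bad n := ~` [set g : mgraph n | many_edges_between R k d g].
have mbad n : measurable (bad n) by [].
have law0 : model_law R m d n (bad n) @[n --> within D \oo] --> 0%E.
  apply: (squeeze_cvge (f := cst 0%E) (h := fun n => (rho ^+ n)%:E)).
  - apply: filterS (withinT D _) => n Dn; rewrite measure_ge0 /=.
    by have := model_law_bad_le (erefl s) Dn th01; rewrite kappaE.
  - exact: cvg_cst.
  apply: cvg_within_filter; apply: cvg_EFin; first exact: nearW.
  by apply: cvg_expr; rewrite ger0_norm.
have := dom bad mbad law0 => Lbad.
rewrite /whp.
have -> : (fun n => L n [set g | many_edges_between R k d g]) =
    (fun n => 1 - L n (bad n))%E.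
  by apply/funext => n; rewrite -probability_setC // setCK.
rewrite -[X in _ --> X]sube0; apply: cvgeB => //; exact: cvg_cst.
Qed.
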